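(* For every $n,k\ge 3$ there is an abstract $n$-polytope whose automorphism group is a Boolean group and which has exactly $k$ flag orbits under its automorphism group.
   Context: A poset is flagged if it has a least and a greatest element and all its maximal chains (flags) have the same finite cardinality, say $n+2$; it then has an order-preserving rank function onto $\{-1,0,\dots,n\}$. Two flags are $i$-adjacent if they differ exactly in their element of rank $i$. An (abstract) $n$-polytope is a flagged poset with rank function onto $\{-1,\dots,n\}$ such that (diamond condition) for each flag $\Phi$ and each $i\in\{0,\dots,n-1\}$ there is a unique flag that is $i$-adjacent to $\Phi$; and (strong flag connectedness) any two flags $\Phi,\Psi$ are joined by a sequence of flags, consecutive ones adjacent, all containing $\Phi\cap\Psi$. Automorphisms are order-preserving bijections with order-preserving inverse. A Boolean group (elementary abelian $2$-group) is a group in which every non-trivial element has order exactly $2$. *)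

(* Defs.v *)
From HB Require Import structures.
From mathcomp Require Import all_boot all_order all_algebra.
From mathcomp Require Import boolp classical_sets functions cardinality.

Set Implicit Arguments.
Unset Strict Implicit.
Unset Printing Implicit Defensive.

Import Order.TTheory GRing.Theory Num.Theory.

Local Open Scope classical_set_scope.
Local Open Scope card_scope.
Local Open Scope order_scope.

Section Polytopes.
Context {d : Order.disp_t} (T : porderType d).

Definition chain (C : set T) : Prop := total_on C (fun x y => x <= y).

Definition flag (F : set T) : Prop :=
  chain F /\ forall C : set T, chain C -> F `<=` C -> C = F.

Definition flagged (n : nat) : Prop :=
  [/\ exists b : T, forall x : T, b <= x,
      exists t : T, forall x : T, x <= t
    & forall F : set T, flag F -> F #= `I_n.+2].

(* Strict monotonicity, together with the common size n + 2 of the flags,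
   makes such a function restrict to a bijection from every flag onto
   {-1, ..., n}; hence it is unique on a flagged poset. *)
Definition rank_function (n : nat) (rk : T -> int) : Prop :=
  {homo rk : x y / x < y >-> (x < y)%R} /\
  range rk = [set i : int | (-1 <= i <= n%:Z)%R].

Definition iadjacent (rk : T -> int) (i : int) (F G : set T) : Prop :=
  F <> G /\ forall x : T, rk x <> i -> (F x <-> G x).

Definition diamond_condition (n : nat) (rk : T -> int) : Prop :=
  forall (F : set T) (i : int), flag F -> (0 <= i < n%:Z)%R ->
    exists! G : set T, flag G /\ iadjacent rk i F G.

(* The sequence of flags is s 0, ..., s m. *)
Definition strongly_flag_connected (rk : T -> int) : Prop :=
  forall F G : set T, flag F -> flag G ->
    exists (m : nat) (s : nat -> set T),
      [/\ s 0%N = F, s m = G,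
          forall j : nat, (j <= m)%N -> flag (s j) /\ F `&` G `<=` s j
        & forall j : nat, (j < m)%N ->
            exists i : int, iadjacent rk i (s j) (s j.+1)].

Definition abstract_polytope (n : nat) : Prop :=
  flagged n /\
  exists rk : T -> int,
    [/\ rank_function n rk, diamond_condition n rk
      & strongly_flag_connected rk].

Record automorphism := Automorphism {
  aut_fun :> T -> T;
  aut_inv : T -> T;
  aut_funK : cancel aut_fun aut_inv;
  aut_invK : cancel aut_inv aut_fun;
  aut_fun_homo : {homo aut_fun : x y / x <= y};
  aut_inv_homo : {homo aut_inv : x y / x <= y}
}.

Lemma automorphismP (f g : automorphism) : f =1 g -> f = g.
Proof.
case: f g => [f f' fK f'K fh f'h] [g g' gK g'K gh g'h] /= /funext fg.
subst g.
have eq' : f' = g' by apply/funext => x; rewrite -{1}(g'K x) fK.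
subst g'.
by congr Automorphism; exact: Prop_irrelevance.
Qed.

Definition aut_one : automorphism.
Proof. by exists id id. Defined.

Definition aut_mul (f g : automorphism) : automorphism.
Proof.
exists (f \o g) (aut_inv g \o aut_inv f).
- exact: can_comp (aut_funK f) (aut_funK g).
- exact: can_comp (aut_invK g) (aut_invK f).
- by move=> x y xy /=; do 2 apply: aut_fun_homo.
- by move=> x y xy /=; do 2 apply: aut_inv_homo.
Defined.

Definition aut_inverse (f : automorphism) : automorphism :=
  Automorphism (aut_invK f) (aut_funK f)
               (@aut_inv_homo f) (@aut_fun_homo f).

HB.instance Definition _ := gen_eqMixin automorphism.
HB.instance Definition _ := gen_choiceMixin automorphism.

Fact aut_mulA : associative aut_mul.
Proof. by move=> f g h; apply: automorphismP. Qed.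

Fact aut_1mul : left_id aut_one aut_mul.
Proof. by move=> f; apply: automorphismP. Qed.

Fact aut_mul1 : right_id aut_one aut_mul.
Proof. by move=> f; apply: automorphismP. Qed.

Fact aut_mulV : left_inverse aut_one aut_inverse aut_mul.
Proof. by move=> f; apply: automorphismP => x /=; rewrite aut_funK. Qed.

Fact aut_Vmul : right_inverse aut_one aut_inverse aut_mul.
Proof. by move=> f; apply: automorphismP => x /=; rewrite aut_invK. Qed.

HB.instance Definition _ := isGroup.Build automorphism
  aut_mulA aut_1mul aut_mul1 aut_mulV aut_Vmul.

Definition flag_orbit (F : set T) : set (set T) :=
  [set [set g x | x in F] | g in [set: automorphism]].

Definition flag_orbits : set (set (set T)) := [set flag_orbit F | F in flag].

End Polytopes.

Arguments flag_orbits {d} T.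

Definition has_order (G : groupType) (g : G) (m : nat) : Prop :=
  [/\ (0 < m)%N, (g ^+ m = 1)%g
    & forall j : nat, (0 < j < m)%N -> (g ^+ j <> 1)%g].

Definition boolean_group (G : groupType) : Prop :=
  forall g : G, g <> 1%g -> has_order g 2.

(* Main.v *)
(* On the sphere, take a square and replace each edge of one pair of opposite
   sides by k - 1 parallel edges; for k = 3 this is the prism over a digon. For
   n > 3, the faces of each rank 3, ..., n - 1 are two new ones, incident with
   everything of any other rank. The flags at a vertex of the map form a cycle of
   length 2k. Two commuting reflections act simply transitively on the 4 vertices,
   a third one reverses the cycle at every vertex, and the two faces of each
   rank >= 3 can be swapped; these generate a Boolean group with k orbits on
   flags, numbered by the distance in the cycle from the two flags on a simple
   edge. Simple edges are the only edges all of whose incident 2-faces contain all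
   four vertices, so every automorphism agrees with one of these symmetries on
   some flag, hence everywhere, by rigidity. *)

Require Import Defs.
From HB Require Import structures.
From mathcomp Require Import all_boot all_order all_algebra.
From mathcomp Require Import boolp classical_sets functions cardinality.
From mathcomp Require Import zify.

Set Implicit Arguments.
Unset Strict Implicit.
Unset Printing Implicit Defensive.

Import Order.TTheory GRing.Theory Num.Theory.

Local Open Scope classical_set_scope.
Local Open Scope card_scope.

(* A poset presented by its flags, in the style of a coset geometry: [key i d] is
   the element of the flag coded by [d] in the i-th position, that is, of rank
   i - 1 in the numbering of [rank_function]; two elements are comparable when some
   flag contains both. Glueing says that the lower part of a flag and the upper
   part of another one sharing an element with it make a flag; this is what
   transitivity of the order needs. *)
Record flag_system (n : nat) := FlagSystem {
  code : Type;
  code0 : code;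
  label : choiceType;
  key : nat -> code -> label;
  key_bot : forall d d', key 0 d = key 0 d';
  key_top : forall d d', key n.+1 d = key n.+1 d';
  key_glue : forall (j : nat) (d d' : code), (j <= n.+1)%N -> key j d = key j d' ->
    exists d'', (forall i, (i <= j)%N -> key i d'' = key i d) /\
                (forall i, (j <= i)%N -> key i d'' = key i d') }.

(** * The poset of a flag system and its flags *)

Section Faces.
Variables (n : nat) (S : flag_system n).
Implicit Types (d : code S).

Definition is_face (u : nat * label S) : bool :=
  (u.1 <= n.+1)%N && `[< exists d, key u.1 d = u.2 >].

Definition face := {u | is_face u}.
HB.instance Definition _ := Choice.on face.

Implicit Types (x y z : face).

Definition frank x : nat := (val x).1.
Definition thru d x : Prop := key (frank x) d = (val x).2.
Definition fle x y : bool :=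
  (frank x <= frank y)%N && `[< exists d, thru d x /\ thru d y >].

Lemma frank_le x : (frank x <= n.+1)%N.
Proof. by have /andP[] := valP x. Qed.

Lemma thru_ex x : exists d, thru d x.
Proof. by have /andP[_ /asboolP] := valP x. Qed.

Lemma thru_inj d x y : thru d x -> thru d y -> frank x = frank y -> x = y.
Proof.
rewrite /thru => dx dy rxy; apply: val_inj; apply: injective_projections => //.
by rewrite -dx -dy rxy.
Qed.

Lemma face_at_ex d i : (i <= n.+1)%N -> exists x, thru d x /\ frank x = i.
Proof.
move=> lei; have fx : is_face (i, key i d).
  by rewrite /is_face lei /=; apply/asboolP; exists d.
by exists (Sub (i, key i d) fx).
Qed.

Lemma eq_key_thru d d' x : key (frank x) d = key (frank x) d' -> thru d x -> thru d' x.
Proof. by rewrite /thru => ->. Qed.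

Lemma thru_eq_key d d' x : thru d x -> thru d' x -> key (frank x) d = key (frank x) d'.
Proof. by rewrite /thru => -> ->. Qed.

Lemma thru_glue d d' x : thru d x -> thru d' x ->
  exists d'', (forall y, (frank y <= frank x)%N -> thru d y -> thru d'' y) /\
              (forall y, (frank x <= frank y)%N -> thru d' y -> thru d'' y).
Proof.
move=> dx d'x; have [d'' [lo hi]] := key_glue (frank_le x) (thru_eq_key dx d'x).
exists d''; split=> y le_y; apply: eq_key_thru; first by rewrite lo.
by rewrite hi.
Qed.

Lemma fle_refl : reflexive fle.
Proof.
by move=> x; rewrite /fle leqnn; apply/asboolP; have [d dx] := thru_ex x; exists d.
Qed.

Lemma fle_anti : antisymmetric fle.
Proof.
move=> x y /andP[/andP[xy /asboolP[d [dx dy]]] /andP[yx _]].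
by apply: (thru_inj dx dy); apply/eqP; rewrite eqn_leq xy.
Qed.

Lemma fle_trans : transitive fle.
Proof.
move=> y x z /andP[xy /asboolP[d [dx dy]]] /andP[yz /asboolP[d' [d'y d'z]]].
rewrite /fle (leq_trans xy yz); apply/asboolP.
have [d'' [lo hi]] := thru_glue dy d'y.
by exists d''; split; [apply: lo | apply: hi].
Qed.

HB.instance Definition _ := Order.Le_isPOrder.Build (Order.Disp tt tt) face
  fle_refl fle_anti fle_trans.

Local Open Scope order_scope.

Lemma face_leP x y : x <= y <-> (frank x <= frank y)%N /\ exists d, thru d x /\ thru d y.
Proof.
by split=> [/andP[? /asboolP ?] // | [xy xdy]]; apply/andP; split=> //; apply/asboolP.
Qed.

Lemma le_frank x y : x <= y -> (frank x <= frank y)%N.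
Proof. by case/face_leP. Qed.

Lemma le_frank_eq x y : x <= y -> frank x = frank y -> x = y.
Proof. by case/face_leP=> _ [d [dx dy]]; apply: thru_inj dx dy. Qed.

Lemma lt_frank x y : x < y -> (frank x < frank y)%N.
Proof.
rewrite lt_def => /andP[/eqP nxy xy]; rewrite ltn_neqAle le_frank // andbT.
by apply/eqP => /(le_frank_eq xy) exy; apply: nxy.
Qed.

Lemma thru_le d x y : thru d x -> thru d y -> (frank x <= frank y)%N -> x <= y.
Proof. by move=> dx dy xy; apply/face_leP; split=> //; exists d. Qed.

Definition flag_of d : set face := thru d.

Lemma flag_of_chain d : chain (flag_of d).
Proof.
move=> x y dx dy; case/orP: (leq_total (frank x) (frank y)) => xy.
  by left; apply: (@thru_le d).
by right; apply: (@thru_le d).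
Qed.

(* The element [z] is what makes the induction on [m] go through: glueing at the
   element of position [m] needs a flag through it and [z]. *)
Lemma chain_below (F : set face) m z : chain F -> (m <= frank z)%N ->
    (forall x, F x -> x <= z \/ z <= x) ->
  exists d, thru d z /\ forall x, F x -> (frank x < m)%N -> thru d x.
Proof.
move=> cF; elim: m z => [|m IH] z mz Fz; first by have [d dz] := thru_ex z; exists d.
have [[x [Fx rx]]|noF] := pselect (exists x, F x /\ frank x = m); last first.
  have [d [dz dF]] := IH z (ltnW mz) Fz; exists d; split=> // x Fx.
  rewrite ltnS leq_eqVlt => /orP[/eqP rx|]; last exact: dF.
  by case: noF; exists x.
have [||d [dx dF]] := IH x; first by rewrite rx.
  by move=> y Fy; apply: cF.
have xz : x <= z.
  by case: (Fz x Fx) => // /le_frank; rewrite rx leqNgt mz.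
have [_ [d' [d'x d'z]]] := (face_leP _ _).1 xz.
have [d'' [lo hi]] := thru_glue dx d'x; exists d''; split.
  by apply: hi => //; apply: le_frank.
move=> y Fy; rewrite ltnS => ry; apply: lo; first by rewrite rx.
move: ry; rewrite leq_eqVlt => /orP[/eqP ry|]; last exact: dF.
suff -> : y = x by [].
by case: (cF _ _ Fy Fx) => yx; [|apply/esym]; apply: le_frank_eq; rewrite // rx ry.
Qed.

Lemma thru_top d x : frank x = n.+1 -> thru d x.
Proof.
move=> rx; have [d' d'x] := thru_ex x.
by apply: eq_key_thru d'x; rewrite rx; apply: key_top.
Qed.

Lemma thru_bot d x : frank x = 0%N -> thru d x.
Proof.
move=> rx; have [d' d'x] := thru_ex x.
by apply: eq_key_thru d'x; rewrite rx; apply: key_bot.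
Qed.

(** A code has an element in every position, and comparable elements of equal rank coincide, so its
    chain cannot grow. Conversely, [chain_below] at the top element gives a code through the rest of
    a maximal chain, and every code passes through the top. *)
Lemma flagP (F : set face) : flag F <-> exists d, F = flag_of d.
Proof.
split=> [[cF maxF]|[d ->]]; last first.
  split=> [|C cC dC]; first exact: flag_of_chain.
  apply/seteqP; split=> // y Cy.
  have [x [dx rx]] := face_at_ex d (frank_le y).
  suff -> : y = x by [].
  by case: (cC _ _ Cy (dC _ dx)) => yx; [|apply/esym]; apply: le_frank_eq.
have [t [_ rt]] := face_at_ex (code0 S) (leqnn n.+1).
have [||d [_ dF]] := @chain_below F n.+1 t cF; first by rewrite rt.
  move=> x _; left; have [d dx] := thru_ex x; apply: (@thru_le d) => //.
    exact: thru_top.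
  by rewrite rt frank_le.
exists d; apply/esym/maxF; first exact: flag_of_chain.
move=> x Fx; have := frank_le x; rewrite leq_eqVlt => /orP[/eqP|]; last exact: dF.
exact: thru_top.
Qed.

Lemma flag_of_sub d d' : (flag_of d `<=` flag_of d') -> flag_of d = flag_of d'.
Proof.
move=> sub; apply/seteqP; split=> // x d'x.
have [y [dy ry]] := face_at_ex d (frank_le x).
by rewrite (thru_inj d'x (sub _ dy)).
Qed.

Lemma faces_flagged : flagged face n.
Proof.
split.
- have [b [_ rb]] := face_at_ex (code0 S) (leq0n n.+1); exists b => x.
  by have [d dx] := thru_ex x; apply: (@thru_le d); rewrite ?rb //; apply: thru_bot.
- have [t [_ rt]] := face_at_ex (code0 S) (leqnn n.+1); exists t => x.
  by have [d dx] := thru_ex x; apply: (@thru_le d); rewrite ?rt ?frank_le //; apply: thru_top.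
move=> F /flagP[d ->].
have inj : {in flag_of d &, injective frank}.
  by move=> x y /set_mem dx /set_mem dy; apply: thru_inj dx dy.
rewrite -(card_eql (inj_card_eq inj)).
suff -> : frank @` flag_of d = `I_n.+2 by [].
apply/seteqP; split=> [_ [x _ <-]|i /= lei]; first exact: frank_le.
by have [x [dx rx]] := face_at_ex d (lei : (i <= n.+1)%N); exists x.
Qed.

(** * Rank function, diamond condition and strong connectedness in terms of codes *)

Definition face_rank x : int := ((frank x)%:Z - 1)%R.

Lemma faces_rank_function : rank_function n face_rank.
Proof.
split=> [x y /lt_frank xy|]; first by rewrite /face_rank; lia.
apply/seteqP; split=> [_ [x _ <-]|i /= /andP[i_ge i_le]].
  by have := frank_le x; rewrite /face_rank /=; lia.
have [|x [_ rx]] := @face_at_ex (code0 S) (absz (i + 1)%R); first by lia.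
by exists x => //; rewrite /face_rank rx; lia.
Qed.

(** Agreement in position [i] is allowed too, which makes this an equivalence relation on codes. *)
Definition eq_off (i : nat) d d' : Prop :=
  forall j, (j <= n.+1)%N -> j <> i -> key j d = key j d'.

Lemma eq_off_thru i d d' : eq_off i d d' <->
  forall x, frank x <> i -> (thru d x <-> thru d' x).
Proof.
split=> [dd' x rx|dd' j lej ji].
  by have e := dd' _ (frank_le x) rx; split; apply: eq_key_thru; rewrite e.
have [x [dx rx]] := face_at_ex d lej; rewrite -rx; apply: thru_eq_key => //.
by apply/dd'; rewrite ?rx.
Qed.

Lemma eq_off_sym i d d' : eq_off i d d' -> eq_off i d' d.
Proof. by move=> dd' j lej ji; rewrite dd'. Qed.

Lemma eq_off_trans i d d' d'' : eq_off i d d' -> eq_off i d' d'' -> eq_off i d d''.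
Proof. by move=> h h' j lej ji; rewrite h // h'. Qed.

Lemma eq_flag_of d d' : flag_of d = flag_of d' <->
  forall j, (j <= n.+1)%N -> key j d = key j d'.
Proof.
split=> [dd' j lej|dd'].
  have [x [dx rx]] := face_at_ex d lej; rewrite -rx; apply: thru_eq_key => //.
  by rewrite -/(flag_of d' x) -dd'.
apply: flag_of_sub => x; apply: eq_key_thru; exact: dd' (frank_le x).
Qed.

Lemma eq_off_flag_of i d d' : eq_off i d d' -> key i d = key i d' ->
  flag_of d = flag_of d'.
Proof.
move=> dd' ei; apply/eq_flag_of => j lej.
by case: (eqVneq j i) => [->|/eqP]; [|apply: dd'].
Qed.

(** Positions [1] to [n] are the ranks [0] to [n - 1]. Uniqueness is stated on keys, since different
    codes may give the same flag. *)
Definition diamond_codes : Prop := forall d i, (0 < i <= n)%N ->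
  exists d', [/\ eq_off i d d', key i d <> key i d'
    & forall d'', eq_off i d d'' -> key i d'' = key i d \/ key i d'' = key i d'].

Lemma faces_diamond : diamond_codes -> diamond_condition n face_rank.
Proof.
move=> diam F i /flagP[d ->] /andP[i_ge0 i_ltn].
pose m := (absz i).+1.
have rkE x : face_rank x <> i <-> frank x <> m by rewrite /face_rank /m; split; lia.
have [|d' [dd' nei uniq]] := diam d m; first by rewrite /m; lia.
exists (flag_of d'); split.
  split; first by apply/flagP; exists d'.
  split=> [/eq_flag_of e|x /rkE]; first by apply: nei; apply: e; rewrite /m; lia.
  exact: (eq_off_thru m d d').1 dd' x.
move=> _ [/flagP[d'' ->] [ndd'' dd'']].
have {}dd'' : eq_off m d d'' by apply/eq_off_thru => x /rkE; apply: dd''.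
have [ei|ei] := uniq _ dd''; first by case: ndd''; apply: (eq_off_flag_of dd'').
by apply: eq_off_flag_of (esym ei); apply: eq_off_trans dd''; apply: eq_off_sym.
Qed.

(** [A] holds the positions kept fixed along the path. Steps may be trivial. *)
Inductive linked (A : nat -> Prop) : code S -> code S -> Prop :=
| linked_eq d d' : (forall j, (j <= n.+1)%N -> key j d = key j d') -> linked A d d'
| linked_step i d d' d'' : ~ A i -> eq_off i d d' -> linked A d' d'' -> linked A d d''.

Lemma linked1 (A : nat -> Prop) i d d' : ~ A i -> eq_off i d d' -> linked A d d'.
Proof. by move=> nA dd'; apply: linked_step dd' (linked_eq _ _). Qed.

Lemma linked_trans (A : nat -> Prop) d d' d'' :
  linked A d d' -> linked A d' d'' -> linked A d d''.
Proof.
elim=> [{}d {}d' e L|i {}d d1 {}d' nA dd1 _ IH /IH]; last exact: linked_step dd1.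
case: L e => [d1 d2 e' e|i d1 d2 d3 nA d12 d23 e].
  by apply: linked_eq => j lej; rewrite e // e'.
by apply: linked_step nA _ d23 => j lej ji; rewrite e // d12.
Qed.

Definition agree d d' (i : nat) : Prop := key i d = key i d'.

Definition linked_codes : Prop := forall d d', linked (agree d d') d d'.

(** Trivial steps are deleted on the way, since adjacent flags must differ. *)
Lemma linked_path (A : nat -> Prop) d d' : linked A d d' ->
  exists (m : nat) (s : nat -> set face),
    [/\ s 0%N = flag_of d, s m = flag_of d',
        forall j, (j <= m)%N -> flag (s j) /\
          forall x, A (frank x) -> thru d x -> s j x
      & forall j, (j < m)%N -> exists i : int, iadjacent face_rank i (s j) (s j.+1)].
Proof.
elim=> {d d'} [d d' /eq_flag_of e|i d d1 d' nAi dd1 _ [m [s [s0 sm sF sadj]]]].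
  by exists 0%N, (fun=> flag_of d); split=> // j _; split=> //; apply/flagP; exists d.
have [e|ne] := pselect (flag_of d = flag_of d1).
  exists m, s; split=> //; first by rewrite s0.
  by move=> j /sF[? sub]; split=> // x Ax; rewrite -/(flag_of d x) e; apply: sub.
exists m.+1, (fun j => if j is j'.+1 then s j' else flag_of d); split=> //.
- case=> [_|j /sF[? sub]]; split=> //; first by apply/flagP; exists d.
  move=> x Ax dx; apply: sub => //.
  by apply: ((eq_off_thru _ _ _).1 dd1 x _).1 dx => rx; apply: nAi; rewrite -rx.
- case=> [_|j]; last exact: sadj.
  exists (i%:Z - 1)%R; rewrite s0; split=> // x rx.
  by apply: ((eq_off_thru _ _ _).1 dd1) => ri; apply: rx; rewrite /face_rank ri.
Qed.

Lemma faces_connected : linked_codes -> strongly_flag_connected face_rank.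
Proof.
move=> link F G /flagP[d ->] /flagP[d' ->].
have [m [s [s0 sm sF sadj]]] := linked_path (link d d'); exists m, s; split=> // j /sF[? sub].
by split=> // x [dx d'x]; apply: sub => //; apply: thru_eq_key.
Qed.

Lemma faces_polytope : diamond_codes -> linked_codes -> abstract_polytope face n.
Proof.
move=> diam link; split; first exact: faces_flagged.
exists face_rank; split; first exact: faces_rank_function.
  exact: faces_diamond.
exact: faces_connected.
Qed.

(** * Automorphisms: preservation of rank, and rigidity *)

Local Notation auto := (automorphism face).

Lemma aut_inj (g : auto) : injective g.
Proof. exact: can_inj (@aut_funK _ _ g). Qed.

Lemma aut_lt (g : auto) x y : x < y -> g x < g y.
Proof.
rewrite !lt_def => /andP[nxy xy]; rewrite aut_fun_homo // andbT.
by rewrite (inj_eq (@aut_inj g)).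
Qed.

(** Induction on the rank: a flag through [x] has an element one rank below [x], whose image lies
    strictly below [g x]. *)
Lemma frank_aut_ge (g : auto) x : (frank x <= frank (g x))%N.
Proof.
move: {2}(frank x) (erefl (frank x)) => m; elim: m x => [x -> //|m IH x rx].
have [d dx] := thru_ex x.
have [|y [dy ry]] := @face_at_ex d m; first by rewrite ltnW // -rx frank_le.
rewrite rx -ry; apply: leq_ltn_trans (IH y ry) _; apply/lt_frank/aut_lt.
rewrite lt_neqAle (thru_le dy dx) ?andbT; last by rewrite rx ry.
by apply/eqP => e; move: rx; rewrite -e ry => /n_Sn.
Qed.

Lemma frank_aut (g : auto) x : frank (g x) = frank x.
Proof.
apply/eqP; rewrite eqn_leq frank_aut_ge andbT.
by have := frank_aut_ge (aut_inverse g) (g x); rewrite /= aut_funK.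
Qed.

Lemma flag_aut (g : auto) d : exists d', forall x, thru d x -> thru d' (g x).
Proof.
suff /flagP[d' e] : flag (g @` flag_of d).
  by exists d' => x dx; rewrite -/(flag_of d' _) -e; exists x.
split=> [_ _ [x dx <-] [y dy <-]|C cC sub].
  by case: (flag_of_chain dx dy) => ?; [left|right]; apply: aut_fun_homo.
apply/seteqP; split=> // y Cy.
have [x [dx rx]] := face_at_ex d (frank_le y).
have Cgx : C (g x) by apply: sub; exists x.
exists x => //; have rgx : frank (g x) = frank y by rewrite frank_aut.
by case: (cC _ _ Cgx Cy) => e; [|apply/esym]; apply: le_frank_eq.
Qed.

(** The image of the flag of [d'] agrees with the flag of [d] off position [i], so the diamond
    condition leaves only the flags of [d] and [d'] for it. *)
Lemma aut_fix_step (g : auto) i d d' : diamond_codes -> eq_off i d d' ->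
  (forall x, thru d x -> g x = x) -> forall x, thru d' x -> g x = x.
Proof.
move=> diam dd' gd x d'x.
have off y : thru d' y -> frank y <> i -> g y = y.
  by move=> d'y ryi; apply/gd/(eq_off_thru _ _ _).1/d'y; first exact: dd'.
have [rxi|/off] := pselect (frank x = i); last exact.
have [e|ne] := pselect (key i d = key i d').
  by apply: gd; apply: eq_key_thru d'x; rewrite rxi.
have i_bnd : (0 < i <= n)%N.
  have := frank_le x; rewrite rxi; case: (posnP i) => [i0|i0] lei.
    by case: ne; rewrite i0; apply: key_bot.
  rewrite /= -ltnS ltn_neqAle lei andbT; apply/eqP => ei.
  by case: ne; rewrite ei; apply: key_top.
have [d1 [_ _ uniq]] := diam d i i_bnd.
have [d2 d2g] := flag_aut g d'.
have d'd2 : eq_off i d' d2.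
  apply/eq_off_thru => y ryi; split=> [d'y|d2y].
    by rewrite -(off y) //; apply: d2g.
  have [z [d'z rz]] := face_at_ex d' (frank_le y).
  have gz : g z = z by apply: off; rewrite ?rz.
  by rewrite (thru_inj d2y _ (esym rz)) // -gz; apply: d2g.
have [e'|e2] := uniq _ (eq_off_trans dd' d'd2); last first.
  have [e'|e'] := uniq _ dd'; first by case: ne.
  have d'gx : thru d' (g x).
    by apply: eq_key_thru (d2g x d'x); rewrite frank_aut rxi e2.
  by apply: thru_inj d'gx d'x _; rewrite frank_aut.
(* Here [g x] lies in the flag of [d], so [g (g x) = g x], and injectivity gives [g x = x]. *)
have dgx : thru d (g x) by apply: eq_key_thru (d2g x d'x); rewrite frank_aut rxi.
by apply: (@aut_inj g); apply: gd.
Qed.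

Lemma aut_rigid (g : auto) d : diamond_codes -> linked_codes ->
  (forall x, thru d x -> g x = x) -> g =1 id.
Proof.
move=> diam link gd x; have [d' d'x] := thru_ex x.
elim: (link d d') gd => [{}d {}d' e gd|i {}d d1 {}d' _ dd1 _ IH gd] in d'x *.
  by apply/gd/eq_key_thru/d'x; rewrite e ?frank_le.
by apply: IH => //; apply: aut_fix_step dd1 gd.
Qed.

Lemma aut_eq (g h : auto) d d' : diamond_codes -> linked_codes ->
  (forall x, thru d x -> thru d' (g x) /\ thru d' (h x)) -> g = h.
Proof.
move=> diam link gh; apply: automorphismP => x.
apply: (can_inj (@aut_invK _ _ h)); rewrite aut_funK.
apply: (@aut_rigid (aut_mul (aut_inverse h) g) d) => // {}x dx /=.
have [gx hx] := gh x dx.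
by rewrite (thru_inj gx hx) ?aut_funK // !frank_aut.
Qed.

(** The condition on keys makes the image of a face independent of the flag chosen through it. *)
Lemma aut_of_code_map (h : code S -> code S) :
    (forall i d d', key i d = key i d' -> key i (h d) = key i (h d')) ->
    involutive h ->
  exists g : auto, involutive g /\ forall d x, thru d x -> thru (h d) (g x).
Proof.
move=> hkey hK.
have img x : exists y, forall d, thru d x -> thru (h d) y /\ frank y = frank x.
  have [d dx] := thru_ex x; have [y [hdy ry]] := face_at_ex (h d) (frank_le x).
  exists y => d' d'x; split=> //; apply: eq_key_thru hdy; rewrite ry.
  by apply: hkey; apply: thru_eq_key.
have [g gP] := choice img.
have gK : involutive g.
  move=> x; have [d dx] := thru_ex x.
  have [hd rx] := gP x d dx; have [hhd rgx] := gP _ _ hd.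
  by rewrite hK in hhd; apply: thru_inj hhd dx _; rewrite rgx.
have ghomo : {homo g : x y / x <= y}.
  move=> x y /face_leP[xy [d [dx dy]]].
  have [gx rx] := gP x d dx; have [gy ry] := gP y d dy.
  by apply: (thru_le gx gy); rewrite rx ry.
by exists (Automorphism gK gK ghomo ghomo); split=> // d x /gP[].
Qed.

Definition code_symmetry (h : code S -> code S) : Prop :=
  involutive h /\ forall i d d', key i d = key i d' -> key i (h d) = key i (h d').

(** * Automorphism group and flag orbits from a colouring of the flags *)

Section Orbits.
Variables (k : nat) (col : code S -> nat) (H : set (code S -> code S)) (d0 : code S).
Hypothesis diam : diamond_codes.
Hypothesis link : linked_codes.
Hypothesis Hsym : forall h, H h -> code_symmetry h.
Hypothesis col_flag : forall d d', flag_of d = flag_of d' -> col d = col d'.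
Hypothesis col_sym : forall h d, H h -> col (h d) = col d.
Hypothesis col_trans : forall d d', col d = col d' ->
  exists2 h, H h & flag_of (h d) = flag_of d'.
Hypothesis col_range : range col = `I_k.
(** Arbitrary automorphisms are only required to keep the colour of the one flag [d0]; rigidity does
    the rest. *)
Hypothesis col_d0 : forall (g : auto) d,
  (forall x, thru d0 x -> thru d (g x)) -> col d = col d0.

(** Some [h] in [H] takes the flag of [d0] to its image under [g], as both have the same colour. The
    automorphism induced by [h] agrees with [g] on this flag, hence everywhere. *)
Lemma aut_code_symmetry (g : auto) :
  involutive g /\ exists2 h, H h & forall d x, thru d x -> thru (h d) (g x).
Proof.
have [d gd] := flag_aut g d0; have [h Hh hd] := col_trans (esym (col_d0 gd)).
have [hK hkey] := Hsym Hh; have [g' [g'K g'h]] := aut_of_code_map hkey hK.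
suff -> : g = g' by split=> //; exists h.
apply: (aut_eq diam link (d := d0) (d' := d)) => x dx; split; first exact: gd.
by rewrite -/(flag_of d _) -hd; apply: g'h.
Qed.

Lemma aut_boolean : boolean_group auto.
Proof.
move=> g ng1; split=> //.
  by apply: automorphismP => x; rewrite expgS expg1; apply: (aut_code_symmetry g).1.
by case=> [|[|j]] //.
Qed.

Lemma flag_aut_image (g : auto) d d' : (forall x, thru d x -> thru d' (g x)) ->
  [set g x | x in flag_of d] = flag_of d'.
Proof.
move=> gd; apply/seteqP; split=> [_ [x dx <-]|y d'y]; first exact: gd.
have [x [dx rx]] := face_at_ex d (frank_le y); exists x => //.
by apply: thru_inj (gd x dx) d'y _; rewrite frank_aut.
Qed.

Lemma flag_orbit_of d : flag_orbit (flag_of d) = [set flag_of d' | d' in [set d' | col d' = col d]].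
Proof.
apply/seteqP; split=> [_ [g _ <-]|_ [d' /= e <-]].
  have [_ [h Hh hd]] := aut_code_symmetry g.
  by exists (h d) => /=; [apply: col_sym|apply/esym/flag_aut_image/hd].
have [h Hh hd] := col_trans (esym e); have [hK hkey] := Hsym Hh.
have [g [_ gh]] := aut_of_code_map hkey hK.
by exists g => //; rewrite -hd; apply/flag_aut_image/gh.
Qed.

Lemma card_flag_orbits : flag_orbits face #= `I_k.
Proof.
pose O (i : nat) := [set flag_of d' | d' in [set d' | col d' = i]].
have -> : flag_orbits face = O @` `I_k.
  rewrite -col_range image_comp; apply/seteqP; split=> [_ [_ /flagP[d ->] <-]|_ [d _ <-]].
    by exists d => //; rewrite flag_orbit_of.
  by exists (flag_of d); [apply/flagP; exists d|rewrite flag_orbit_of].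
apply: inj_card_eq => i j; rewrite -col_range => /set_mem[d _ <-] /set_mem[d' _ <-] e.
have : O (col d') (flag_of d) by rewrite -e; exists d.
by case=> d1 /= <- /col_flag.
Qed.

End Orbits.

End Faces.

(** * The map on the sphere and its upper ranks as a flag system *)

Section DoubledSquare.
Variables (n k : nat).

(* The vertices are the pairs (north, east); the simple edges change [north] and
   the (k - 1)-fold ones change [east]. At each vertex, edges and 2-faces are
   numbered modulo k in cyclic order, the simple edge being 0 and 2-face f lying
   between edges f and f + 1; [turn] is the position of the pair (edge, 2-face) in
   the resulting cycle (0,0), (1,0), (1,1), (2,1), ..., (0,k-1). The 2-faces 0 and
   k - 1 are the squares. Finally, [upper i] selects one of the two elements of
   position i >= 4. *)
Record map_code := MapCode {
  north : bool; east : bool; turn : nat; turnP : (turn < k.*2)%N; upper : nat -> bool }.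

Lemma turn_revP c : (c < k.*2)%N -> (k.*2.-1 - c < k.*2)%N.
Proof. by lia. Qed.

Definition map_sym (a b r : bool) (y : nat -> bool) (d : map_code) : map_code :=
  let: MapCode p q c cP x := d in
  MapCode (a (+) p) (b (+) q)
    (if r as r0 return ((if r0 then k.*2.-1 - c else c) < k.*2)%N then turn_revP cP else cP)
    (fun i => y i (+) x i).

Definition map_color (d : map_code) : nat := minn (turn d) (k.*2.-1 - turn d).

Definition map_syms : set (map_code -> map_code) :=
  [set h | exists a b r y, h = map_sym a b r y].

Hypotheses (n_ge3 : (3 <= n)%N) (k_ge3 : (3 <= k)%N).

(** Turns [2 * e - 1] and [2 * e] lie on edge [e]; the last turn closes the cycle and lies on the
    simple edge [0]. *)
Definition edge_at (c : nat) : nat := if c == k.*2.-1 then 0%N else uphalf c.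
(** In this range both edges [f] and [f + 1] are multiple, so [north] is constant on the 2-face. *)
Definition digon (f : nat) : bool := (0 < f < k.-1)%N.

Lemma digon_edge c : digon c./2 -> edge_at c != 0%N.
Proof. by rewrite /digon /edge_at; case: ifP; lia. Qed.

(* An edge or 2-face forgets the coordinates in which its vertices differ, so a key
   records only the remaining ones, the others being set to [false]. *)
Definition map_key (i : nat) (d : map_code) : nat * bool * bool :=
  let: MapCode p q c _ x := d in
  match i with
  | 0 => (0%N, false, false)
  | 1 => (0%N, p, q)
  | 2 => (edge_at c, (edge_at c != 0%N) && p, (edge_at c == 0%N) && q)
  | 3 => (c./2, digon c./2 && p, false)
  | _ => (0%N, (i <= n)%N && x i, false)
  end.

Lemma zero_turn : (0 < k.*2)%N. Proof. by lia. Qed.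

Definition map_code0 : map_code := MapCode false false zero_turn (fun=> false).

Lemma map_key_bot d d' : map_key 0 d = map_key 0 d'.
Proof. by case: d => ?????; case: d'. Qed.

Lemma map_key_top d d' : map_key n.+1 d = map_key n.+1 d'.
Proof.
case: d => ?????; case: d' => ????? /=.
(* As [3 <= n], position [n.+1] falls under the last case of [map_key], where the guard [i <= n]
   suppresses the bit. *)
by case: n n_ge3 => [|[|[|m]]] // _; rewrite ltnn.
Qed.

Lemma map_key_glue j d d' : (j <= n.+1)%N -> map_key j d = map_key j d' ->
  exists d'', (forall i, (i <= j)%N -> map_key i d'' = map_key i d) /\
              (forall i, (j <= i)%N -> map_key i d'' = map_key i d').
Proof.
case: d => p q c cP x; case: d' => p' q' c' c'P x' _.
case: j => [|[|[|[|j]]]] e.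
- by exists (MapCode p' q' c'P x'); split=> // -[].
- by exists (MapCode p' q' c'P x'); split=> // -[|[]].
- exists (MapCode p q c'P x'); split=> -[|[|[|[|i]]]] //= _.
  + by case: e => ->.
  + by case: e => ee; rewrite ee => -> ->.
  (* If the 2-face of [d'] is a digon, the common edge is multiple and its key fixes [north], so
     [p = p']. *)
  + case: e => ee; rewrite ee => ep _; congr (_, _, _).
    by case dg: (digon _) => //; rewrite (digon_edge dg) in ep.
- exists (MapCode p q cP x'); split=> -[|[|[|[|i]]]] //= _.
exists (MapCode p q cP (fun i => if (i <= j.+4)%N then x i else x' i)).
split=> -[|[|[|[|i]]]] //= lei; first by rewrite lei.
case: ifP => // lij; have ei : i = j by lia.
by rewrite ei; case: e => ->.
Qed.

Definition map_system : flag_system n :=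
  FlagSystem map_code0 map_key_bot map_key_top map_key_glue.

(** * Adjacent flags of the map and the diamond condition *)

Lemma turn_inj c c' : (c < k.*2)%N -> (c' < k.*2)%N ->
  edge_at c = edge_at c' -> c./2 = c'./2 -> c = c'.
Proof. by rewrite /edge_at; case: ifP; case: ifP; lia. Qed.

(* The turns of the flags adjacent in position 2 (the edge), resp. 3 (the 2-face). *)
Definition turn2 (c : nat) : nat := if odd c then c.-1 else c.+1.

Definition turn3 (c : nat) : nat :=
  if c == 0%N then k.*2.-1 else if c == k.*2.-1 then 0%N else if odd c then c.+1 else c.-1.

Lemma turn2P c : (c < k.*2)%N -> (turn2 c < k.*2)%N.
Proof. by rewrite /turn2; case: ifP; lia. Qed.

Lemma turn3P c : (c < k.*2)%N -> (turn3 c < k.*2)%N.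
Proof. by rewrite /turn3; do ! case: ifP => ?; lia. Qed.

Lemma half_turn2 c : (turn2 c)./2 = c./2.
Proof. by rewrite /turn2; case: ifP; lia. Qed.

Lemma edge_turn3 c : (c < k.*2)%N -> edge_at (turn3 c) = edge_at c.
Proof. by rewrite /turn3 => ?; do ! case: ifP => ?; rewrite /edge_at; do ! case: ifP => ?; lia. Qed.

Lemma edge_turn2 c : (c < k.*2)%N -> edge_at (turn2 c) <> edge_at c.
Proof. by rewrite /turn2 => ?; do ! case: ifP => ?; rewrite /edge_at; do ! case: ifP => ?; lia. Qed.

Lemma half_turn3 c : (c < k.*2)%N -> (turn3 c)./2 <> c./2.
Proof. by rewrite /turn3 => ?; do ! case: ifP => ?; lia. Qed.

Lemma half_eq c c' : c./2 = c'./2 -> c' = c \/ c' = turn2 c.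
Proof. by rewrite /turn2; case: ifP; lia. Qed.

Lemma edge_eq c c' : (c < k.*2)%N -> (c' < k.*2)%N ->
  edge_at c = edge_at c' -> c' = c \/ c' = turn3 c.
Proof.
by rewrite /turn3 => ? ?; do ! case: ifP => ?; rewrite /edge_at; do ! case: ifP => ?; lia.
Qed.

Lemma map_diamond : diamond_codes map_system.
Proof.
move=> [p q c cP x] [|[|[|[|i]]]] //= lei.
(* The other end of the edge. *)
- exists (MapCode (if edge_at c == 0%N then ~~ p else p)
                  (if edge_at c == 0%N then q else ~~ q) cP x).
  split=> [[|[|[|[|j]]]] //= _ _||[p' q' c' c'P x'] dd'].
  + by case: eqP.
  + case dg: (digon _) => //.
    by rewrite (negPf (digon_edge dg)).
  + by case: ifP => _ [] ; case: (p); case: (q).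
  have /= [ee ep eq] := dd' 2 ltac:(lia) ltac:(lia).
  have /= [ef _] := dd' 3 ltac:(lia) ltac:(lia).
  have ec := turn_inj cP c'P ee ef; rewrite -ec in ep eq *.
  move: ep eq; case: eqP => /= _.
    by move=> _ <-; case: (p); case: (p'); [left|right|right|left].
  by move=> <- _; case: (q); case: (q'); [left|right|right|left].
- exists (MapCode p q (turn2P cP) x).
  split=> [[|[|[|[|j]]]] //= _ _||[p' q' c' c'P x'] dd'].
  + by rewrite half_turn2.
  + by case=> e _ _; apply: (edge_turn2 cP).
  have /= [<- <-] := dd' 1 ltac:(lia) ltac:(lia).
  have /= [ef _] := dd' 3 ltac:(lia) ltac:(lia).
  by case: (half_eq ef) => ->; [left|right].
- exists (MapCode p q (turn3P cP) x).
  split=> [[|[|[|[|j]]]] //= _ _||[p' q' c' c'P x'] dd'].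
  + by rewrite edge_turn3.
  + by case=> e _; apply: (half_turn3 cP).
  have /= [<- _] := dd' 1 ltac:(lia) ltac:(lia).
  have /= [ee _ _] := dd' 2 ltac:(lia) ltac:(lia).
  by case: (edge_eq cP c'P ee) => ->; [left|right].
exists (MapCode p q cP (fun j => if j == i.+4 then ~~ x j else x j)).
split=> [[|[|[|[|j]]]] //= _ ji||[p' q' c' c'P x'] dd'] /=.
+ by case: eqP => // e; case: ji; rewrite e.
+ by rewrite eqxx lei => -[]; case: (x i.+4).
by rewrite eqxx lei; case: (x i.+4); case: (x' i.+4); [left|right|right|left].
Qed.

(** * Paths of flags in the map with prescribed fixed positions *)

Section Linking.
Variable A : nat -> Prop.
Local Notation link := (@linked n map_system A).

Lemma linked_turn2 p q c c' cP c'P x : ~ A 2 -> c./2 = c'./2 ->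
  link (@MapCode p q c cP x) (@MapCode p q c' c'P x).
Proof.
by move=> nA e; apply: (linked1 nA) => -[|[|[|[|j]]]] //= _ _; rewrite e.
Qed.

Lemma linked_turn3 p q c c' cP c'P x : ~ A 3 -> edge_at c = edge_at c' ->
  link (@MapCode p q c cP x) (@MapCode p q c' c'P x).
Proof.
by move=> nA e; apply: (linked1 nA) => -[|[|[|[|j]]]] //= _ _; rewrite e.
Qed.

(** All turns are joined through turn [0]: an even turn shares its 2-face with the next one, an odd
    turn its edge. [linked] is directed, so both directions are built together. *)
Lemma linked_turn p q c c' cP c'P x : ~ A 2 -> ~ A 3 ->
  link (@MapCode p q c cP x) (@MapCode p q c' c'P x).
Proof.
move=> nA2 nA3.
have zero b bP : link (@MapCode p q b bP x) (MapCode p q zero_turn x) /\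
                 link (MapCode p q zero_turn x) (@MapCode p q b bP x).
  elim: b bP => [|b IH] bP; first by split; apply: linked_turn2.
  have bP' : (b < k.*2)%N by lia.
  have [fro to] := IH bP'; case ob: (odd b).
    have e : edge_at b = edge_at b.+1 by rewrite /edge_at; do ! case: ifP => ?; lia.
    split; first by apply: linked_trans fro; apply: linked_turn3.
    by apply: linked_trans to _; apply: linked_turn3.
  have e : b./2 = b.+1./2 by lia.
  split; first by apply: linked_trans fro; apply: linked_turn2.
  by apply: linked_trans to _; apply: linked_turn2.
exact: linked_trans (zero c cP).1 (zero c' c'P).2.
Qed.

Lemma linked_north p p' q c cP x : ~ A 1 -> edge_at c = 0%N ->
  link (@MapCode p q c cP x) (@MapCode p' q c cP x).
Proof.
move=> nA e; apply: (linked1 nA) => -[|[|[|[|j]]]] //= _ _; first by rewrite e.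
by case dg: (digon _) => //; have := digon_edge dg; rewrite e.
Qed.

Lemma linked_east p q q' c cP x : ~ A 1 -> edge_at c <> 0%N ->
  link (@MapCode p q c cP x) (@MapCode p q' c cP x).
Proof.
by move=> nA e; apply: (linked1 nA) => -[|[|[|[|j]]]] //= _ _; case: eqP.
Qed.

(** [east] changes along a multiple edge, and every 2-face has one. [north] changes along a simple
    edge, present unless the 2-face is a digon, where [p = p']. *)
Lemma linked_in_face p p' q q' c c' cP c'P x : ~ A 1 -> ~ A 2 -> c./2 = c'./2 ->
    (digon c./2 -> p = p') ->
  link (@MapCode p q c cP x) (@MapCode p' q' c' c'P x).
Proof.
move=> nA1 nA2 ec dg.
have [b [bP eb b0]] : exists b, [/\ (b < k.*2)%N, b./2 = c./2 & edge_at b <> 0%N].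
  case: (eqVneq (edge_at c) 0%N) => [e0|/eqP]; last by exists c.
  exists (turn2 c); rewrite turn2P // half_turn2; split=> // e1.
  by apply: (edge_turn2 cP); rewrite e0.
apply: (@linked_trans n map_system A _ (MapCode p q bP x)); first exact: linked_turn2.
apply: (@linked_trans n map_system A _ (MapCode p q' bP x)); first exact: linked_east.
have [<-|npp'] := eqVneq p p'; first by apply: linked_turn2 => //; rewrite eb.
have [a [aP ea a0]] : exists a, [/\ (a < k.*2)%N, a./2 = c./2 & edge_at a = 0%N].
  have ndg : ~~ digon c./2 by apply/negP => /dg /eqP; apply/negP.
  (* The squares [0] and [k - 1] meet the simple edge in turns [0] and [2 * k - 1]. *)
  exists (if c./2 == 0%N then 0%N else k.*2.-1).
  by move: ndg; rewrite /digon /edge_at; case: ifP => ?; split; do ? case: ifP; lia.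
apply: (@linked_trans n map_system A _ (MapCode p q' aP x)).
  by apply: linked_turn2 => //; rewrite ea.
apply: (@linked_trans n map_system A _ (MapCode p' q' aP x)); first exact: linked_north.
by apply: linked_turn2 => //; rewrite ea.
Qed.

(** Bits are changed one at a time from position [4] upwards; those at positions in [A] already
    agree, and those beyond [n] do not enter the keys. *)
Lemma linked_upper p q c cP x x' :
  (forall i, A i.+4 -> (i.+4 <= n)%N -> x i.+4 = x' i.+4) ->
  link (@MapCode p q c cP x) (@MapCode p q c cP x').
Proof.
move=> Ax.
pose mix m i := if (i < m.+4)%N then x' i else x i.
have step m : link (@MapCode p q c cP x) (@MapCode p q c cP (mix m)).
  elim: m => [|m IH]; first by apply: linked_eq => -[|[|[|[|j]]]].
  apply: linked_trans IH _.
  have mixE j : j <> m.+4 -> mix m.+1 j = mix m j.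
    by move=> jm; rewrite /mix; congr (if _ then _ else _); lia.
  have [Am|nAm] := pselect (A m.+4); last first.
    by apply: (linked1 nAm) => -[|[|[|[|j]]]] //= _ ji; rewrite mixE.
  apply: linked_eq => -[|[|[|[|j]]]] //= _; congr (_, _, _).
  have [->|/eqP jm] := eqVneq j.+4 m.+4; last by rewrite mixE.
  by rewrite /mix ltnn ltnSn; case: leqP => //= le_mn; rewrite Ax.
apply: linked_trans (step n) _; apply: linked_eq => -[|[|[|[|j]]]] //= _.
by congr (_, _, _); case: leqP => //= le_jn; rewrite /mix ifT //; lia.
Qed.

End Linking.

Lemma map_linked : linked_codes map_system.
Proof.
(* [A] remains the set of positions common to the original pair while the path runs through other
   codes. *)
move=> d d'; have: forall i, agree d d' i = (key i d = key i d') by [].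
move: (agree d d') => A; case: d => p q c cP x; case: d' => p' q' c' c'P x' AE.
have /= A1 := AE 1; have /= A2 := AE 2; have /= A3 := AE 3.
apply: (@linked_trans n map_system A _ (MapCode p q cP x')).
  by apply: linked_upper => i; rewrite AE /= => + lei; rewrite lei => -[].
have [[ep eq]|n1] := pselect (p = p' /\ q = q').
  rewrite -ep -eq in A1 A2 A3 *.
  have [a2|n2] := pselect (A 2).
    have ee : edge_at c = edge_at c' by move: a2; rewrite A2 => -[].
    have [a3|n3] := pselect (A 3); last exact: linked_turn3.
    have ef : c./2 = c'./2 by move: a3; rewrite A3 => -[].
    have ec := turn_inj cP c'P ee ef.
    by apply: linked_eq => -[|[|[|[|j]]]] //= _; rewrite ec.
  have [a3|n3] := pselect (A 3); last exact: linked_turn.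
  by apply: linked_turn2 => //; move: a3; rewrite A3 => -[].
have nA1 : ~ A 1 by rewrite A1 => -[ep eq]; apply: n1.
have [a2|n2] := pselect (A 2).
  have [ee ep eq] : (edge_at c, (edge_at c != 0%N) && p, (edge_at c == 0%N) && q) =
     (edge_at c', (edge_at c' != 0%N) && p', (edge_at c' == 0%N) && q') by move: a2; rewrite A2.
  (* Both vertices are ends of the common edge, so one step moves the vertex. *)
  apply: (@linked_trans n map_system A _ (MapCode p' q' cP x')).
    apply: (linked1 nA1) => -[|[|[|[|j]]]] //= _ _; first by rewrite ep eq ee.
    by case dg: (digon _) => //; move: ep; rewrite -ee (digon_edge dg) /= => ->.
  have [a3|n3] := pselect (A 3); last exact: linked_turn3.
  have ef : c./2 = c'./2 by move: a3; rewrite A3 => -[].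
  have ec := turn_inj cP c'P ee ef.
  by apply: linked_eq => -[|[|[|[|j]]]] //= _; rewrite ec.
have [a3|n3] := pselect (A 3).
  have [ef ep] : (c./2, digon c./2 && p) = (c'./2, digon c'./2 && p').
    by move: a3; rewrite A3 => -[-> ->].
  by apply: linked_in_face => // dg; move: ep; rewrite -ef dg.
(* With no common vertex, edge or 2-face, the path turns to the square [0], which contains all four
   vertices, crosses it and turns back. *)
apply: (@linked_trans n map_system A _ (MapCode p q zero_turn x')); first exact: linked_turn.
apply: (@linked_trans n map_system A _ (MapCode p' q' zero_turn x')); last exact: linked_turn.
exact: linked_in_face.
Qed.

(** * Symmetries of the map and the colour of a flag *)

Lemma edge_rev c : (c < k.*2)%N ->
  edge_at (k.*2.-1 - c) = if edge_at c == 0%N then 0%N else (k - edge_at c)%N.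
Proof.
rewrite /edge_at => ?; case: (eqVneq c k.*2.-1) => ?;
  by case: (eqVneq (k.*2.-1 - c)%N k.*2.-1) => ? /=; do ? case: ifP => ?; lia.
Qed.

Lemma half_rev c : (c < k.*2)%N -> (k.*2.-1 - c)./2 = (k.-1 - c./2)%N.
Proof. by lia. Qed.

Lemma edge_lt c : (c < k.*2)%N -> (edge_at c < k)%N.
Proof. by rewrite /edge_at; case: ifP; lia. Qed.

Lemma edge_rev0 c : (c < k.*2)%N -> (edge_at (k.*2.-1 - c) == 0%N) = (edge_at c == 0%N).
Proof. by move=> cP; rewrite edge_rev //; have := edge_lt cP; case: ifP; lia. Qed.

Lemma digon_rev c : (c < k.*2)%N -> digon (k.*2.-1 - c)./2 = digon c./2.
Proof. by move=> cP; rewrite half_rev // /digon; lia. Qed.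

Lemma eq_map_code p p' q q' c c' cP c'P x x' : p = p' -> q = q' -> c = c' -> x =1 x' ->
  @MapCode p q c cP x = @MapCode p' q' c' c'P x'.
Proof.
move=> -> -> ec /funext ->; case: c' / ec in c'P *.
by rewrite (bool_irrelevance cP c'P).
Qed.

(** Reversal sends edge [e] to [- e] modulo [k] and 2-face [f] to [k - 1 - f]. It preserves the
    simple edge and the set of digons, so a key and its image retain the same coordinates. *)
Lemma map_symP a b r y : @code_symmetry n map_system (map_sym a b r y).
Proof.
split=> [[p q c cP x]|i [p q c cP x] [p' q' c' c'P x']].
  apply: eq_map_code => [|||i]; rewrite ?addKb //.
  by case: r => //=; lia.
case: i => [|[|[|[|i]]]] //=.
- by case=> -> ->.
- case=> ee ep eq.
  have -> : edge_at (if r then k.*2.-1 - c else c) = edge_at (if r then k.*2.-1 - c' else c').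
    by case: r; rewrite // !edge_rev // ee.
  have -> : (edge_at (if r then k.*2.-1 - c' else c') == 0%N) = (edge_at c' == 0%N).
    by case: r; rewrite ?edge_rev0.
  by move: ep eq; rewrite ee; case: eqP => /= _ => [_ ->|-> _].
- case=> ef ep.
  have -> : (if r then k.*2.-1 - c else c)./2 = (if r then k.*2.-1 - c' else c')./2.
    by case: r; rewrite // !half_rev // ef.
  have -> : digon (if r then k.*2.-1 - c' else c')./2 = digon c'./2.
    by case: r; rewrite ?digon_rev.
  by move: ep; rewrite ef; case: digon => //= ->.
by case: (i.+4 <= n)%N => //= -[->].
Qed.

Lemma map_color_flag (d d' : code map_system) :
  flag_of d = flag_of d' -> map_color d = map_color d'.
Proof.
move=> /eq_flag_of e.
have /= e2 := e 2 ltac:(lia); have /= e3 := e 3 ltac:(lia).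
case: d d' e2 e3 {e} => [p q c cP x] [p' q' c' c'P x'] [ee _ _] [ef _].
by rewrite /map_color /= (turn_inj cP c'P ee ef).
Qed.

Lemma map_color_sym h d : map_syms h -> map_color (h d) = map_color d.
Proof.
by move=> [a [b [r [y ->]]]]; case: d => p q c cP x; rewrite /map_color /=; case: r; lia.
Qed.

Lemma map_color_trans d d' : map_color d = map_color d' ->
  exists2 h, map_syms h & h d = d'.
Proof.
case: d => p q c cP x; case: d' => p' q' c' c'P x'; rewrite /map_color /= => e.
(* Equal colours mean [c' = c] or [c' = 2 * k - 1 - c], so the cycle is reversed exactly when the
   turns differ. *)
exists (map_sym (p (+) p') (q (+) q') (c != c') (fun i => x i (+) x' i)).
  by exists (p (+) p'), (q (+) q'), (c != c'), (fun i => x i (+) x' i).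
apply: eq_map_code => [|||i]; last 1 first.
- by case: (x i); case: (x' i).
- by case: (p); case: (p').
- by case: (q); case: (q').
- by case: eqP => //=; lia.
Qed.

Lemma map_color_range : range map_color = `I_k.
Proof.
apply/seteqP; split=> [_ [[p q c cP x] _ <-]|i /= ik]; first by rewrite /map_color /=; lia.
have iP : (i < k.*2)%N by lia.
by exists (MapCode false false iP (fun=> false)) => //; rewrite /map_color /=; lia.
Qed.

(* The flag [map_code0] lies on a simple edge [e]. If [g e] were multiple, it would
   lie on a digon [f], which misses some vertex [v]. *)
Lemma map_color0 (g : automorphism (face map_system)) (d : code map_system) :
  (forall x, thru (map_code0 : code map_system) x -> thru d (g x)) ->
  map_color d = map_color map_code0.
Proof.
case: d => p q c cP x gd.
have [e0|ne0] := eqVneq (edge_at c) 0%N.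
  (* The turns on the simple edge, [0] and [2 * k - 1], both have colour [0]. *)
  by move: e0; rewrite /map_color /edge_at /=; case: ifP; lia.
(* If the 2-face at turn [c] is a square, the one across the multiple edge is a digon, because
   [3 <= k]. *)
have [b [bP eb dg]] : exists b, [/\ (b < k.*2)%N, edge_at b = edge_at c & digon b./2].
  case dg: (digon c./2); first by exists c.
  exists (turn3 c); rewrite turn3P // edge_turn3 //; split=> //.
  by move: ne0 dg; rewrite /edge_at /digon /turn3; do ? case: ifP => ?; lia.
pose d2 : code map_system := MapCode p q bP x.
pose d3 : code map_system := MapCode (~~ p) q bP x.
have [e [e_0 re]] := @face_at_ex n map_system map_code0 2 ltac:(lia).
have [f [f_2 rf]] := @face_at_ex n map_system d2 3 ltac:(lia).
have [v [v_3 rv]] := @face_at_ex n map_system d3 1 ltac:(lia).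
have ge_2 : thru d2 (g e).
  by apply: eq_key_thru (gd e e_0); rewrite frank_aut re /= eb.
pose g' := aut_inverse g.
have /face_leP[_ [[p1 q1 c1 c1P x1] [d1e d1f]]] : (e <= g' f)%O.
  rewrite -(aut_funK g e); apply: (aut_fun_homo g').
  by apply: (thru_le ge_2 f_2); rewrite frank_aut re rf.
have [[pv qv cv cvP xv] dv] := thru_ex (g' v).
(* The 2-face [g' f] contains the simple edge [e], so it is a square and contains every vertex.
   Applying [g] then puts [v] on [f], against the opposite value of [north] in [d3]. *)
have le_vf : (g' v <= g' f)%O.
  apply: (@thru_le n map_system (MapCode pv qv c1P x1)).
  - by apply: eq_key_thru dv; rewrite frank_aut rv.
  - apply: eq_key_thru d1f; rewrite frank_aut rf /=.
    have e1 := thru_eq_key d1e e_0; rewrite re /= in e1; case: e1 => e1 _ _.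
    have e10 : edge_at c1 = 0%N by rewrite e1 /edge_at; case: ifP.
    by case dg1: (digon _) => //; have := digon_edge dg1; rewrite e10.
  by rewrite !frank_aut rv rf.
have := aut_fun_homo g le_vf; rewrite /= !aut_invK.
move=> /face_leP[_ [[p4 q4 c4 c4P x4] [d4v d4f]]].
have := thru_eq_key d4v v_3; rewrite rv /= => -[ep _].
have := thru_eq_key d4f f_2; rewrite rf /= => -[ef].
by rewrite ef dg ep /=; case: (p).
Qed.

End DoubledSquare.

Theorem corollary5p9 (n k : nat) (hn : (3 <= n)%N) (hk : (3 <= k)%N) :
  exists (d : Order.disp_t) (T : porderType d),
    [/\ abstract_polytope T n,
        boolean_group (automorphism T)
      & flag_orbits T #= `I_k].
Proof.
pose S := map_system hn hk.
have diam : diamond_codes S := @map_diamond n k hn hk.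
have link : linked_codes S := @map_linked n k hn hk.
have Hsym h : map_syms h -> code_symmetry (S := S) h.
  by move=> [a [b [r [y ->]]]]; apply: map_symP.
have trans (d d' : code S) : map_color d = map_color d' ->
    exists2 h, map_syms h & flag_of (h d : code S) = flag_of d'.
  by move=> /(map_color_trans hn hk)[h Hh <-]; exists h.
have col0 := @map_color0 n k hn hk.
exists _, (face S); split; first exact: faces_polytope.
  exact: (aut_boolean diam link Hsym trans col0).
apply: (card_flag_orbits diam link Hsym _ _ trans _ col0).
- exact: map_color_flag.
- exact: map_color_sym.
exact: map_color_range.
Qed.
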